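(* For any path $\omega\in\Omega$, the set $\mathcal{I}^{\circledcirc}_{\mathrm{ML}}(\omega)$ of all interval forecasts that make $\omega$ weakly Martin-L\''of random is closed under (finite) intersections: for any two interval forecasts $I$ and $J$ in $\mathcal{I}^{\circledcirc}_{\mathrm{ML}}(\omega)$, we have that $I\cap J\in\mathcal{I}^{\circledcirc}_{\mathrm{ML}}(\omega)$ (in particular, $I\cap J\neq\emptyset$).
   Context: Notation: $\mathbb{N}=\{1,2,\dots\}$, $\mathbb{N}_0=\mathbb{N}\cup\{0\}$. Situations are the finite binary sequences $\mathbb{S}=\bigcup_{n\in\mathbb{N}_0}\{0,1\}^n$, with $\square$ the empty sequence; $sx$ is $s$ with $x\in\{0,1\}$ appended. Paths are elements $\omega$ of $\Omega=\{0,1\}^{\mathbb{N}}$; $\omega_{1:n}\in\mathbb{S}$ consists of the first $n$ entries. $\mathcal{I}$ is the set of non-empty closed subintervals of $[0,1]$ (interval forecasts). For $f\colon\{0,1\}\to\mathbb{R}$ and $I\in\mathcal{I}$, $\overline{E}_I(f)=\max_{p\in I}[pf(1)+(1-p)f(0)]$. A forecasting system is a map $\varphi\colon\mathbb{S}\to\mathcal{I}$. For $I\in\mathcal{I}$, the stationary forecasting system $\gamma_I$ is given by $\gamma_I(s)=I$ for all $s\in\mathbb{S}$. A real process is a map $F\colon\mathbb{S}\to\mathbb{R}$, with $\Delta F(s)(x)=F(sx)-F(s)$. A test process is a non-negative real process with $F(\square)=1$. A supermartingale for $\varphi$ is a real process $M$ with $\overline{E}_{\varphi(s)}(\Delta M(s))\le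 0$ for all $s\in\mathbb{S}$; a test supermartingale for $\varphi$ is a test process that is a supermartingale for $\varphi$. A multiplier process is a map $D$ from $\mathbb{S}$ to non-negative maps $D(s)\colon\{0,1\}\to\mathbb{R}$; it generates the test process $D^{\circledcirc}$ given by $D^{\circledcirc}(\square)=1$ and $D^{\circledcirc}(sx)=D^{\circledcirc}(s)D(s)(x)$ for all $s\in\mathbb{S}$, $x\in\{0,1\}$. ''Recursive'' means computable by a Turing machine (countable sets such as $\mathbb{S}$ and $\mathbb{S}\times\mathbb{N}_0$ are identified with $\mathbb{N}_0$ by recursive bijections with recursive inverse). A real process $F$ is lower semicomputable if there is a recursive family of rationals $r_{s,n}$ ($s\in\mathbb{S}$, $n\in\mathbb{N}_0$) that is non-decreasing in $n$ with $\lim_{n\to\infty}r_{s,n}=F(s)$ for all $s$. A multiplier process $D$ is lower semicomputable if the real processes $D(\cdot)(0)$ and $D(\cdot)(1)$ are. Let $\mathbb{A}^{\circledcirc}_{\mathrm{ML}}$ be the set of all test processes of the form $D^{\circledcirc}$ with $D$ a lower semicomputable multiplier process. A path $\omega$ is weakly Martin-L\''of random for $\varphi$ if $\sup_{n\in\mathbb{N}}T(\omega_{1:n})<\infty$ for every $T\in\mathbb{A}^{\circledcirc}_{\mathrm{ML}}$ that is a test supermartingale for $\varphi$ (equivalently, for every test supermartingale $T=D^{\circledcirc}$ generated by a lower semicomputable multiplier process $D$ with $\overline{E}_{\varphi(s)}(D(s))\le 1$ for all $s\in\mathbb{S}$). $\mathcal{I}^{\circledcirc}_{\mathrm{ML}}(\omega)=\{I\in\mathcal{I}:\omega\text{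 is weakly Martin-L\''of random for }\gamma_I\}$. *)

(* Defs.v *)
From mathcomp Require Import all_boot all_order all_algebra.
From mathcomp Require Import all_classical all_reals all_analysis.
From mathcomp Require Import ring.

Set Implicit Arguments.
Unset Strict Implicit.
Unset Printing Implicit Defensive.

Import Order.TTheory GRing.Theory Num.Theory.
Import numFieldNormedType.Exports.

Local Open Scope classical_set_scope.
Local Open Scope ring_scope.

(* The total recursive functions: the least class containing the initial
   functions and closed under composition, primitive recursion (on the first
   argument) and minimisation of regular functions. *)
Inductive recursive : forall k, (k.-tuple nat -> nat) -> Prop :=
| recursive_zero k : @recursive k (fun=> 0%N)
| recursive_succ : @recursive 1 (fun v => (thead v).+1)
| recursive_proj k (i : 'I_k) : @recursive k (fun v => tnth v i)
| recursive_comp k m (g : m.-tuple nat -> nat)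
    (h : 'I_m -> k.-tuple nat -> nat) :
    recursive g -> (forall i, recursive (h i)) ->
    @recursive k (fun v => g [tuple h i v | i < m])
| recursive_prim k (g : k.-tuple nat -> nat) (h : k.+2.-tuple nat -> nat) :
    recursive g -> recursive h ->
    @recursive k.+1 (fun v =>
      nat_rect (fun=> nat) (g [tuple of behead v])
        (fun n y => h [tuple of n :: y :: behead v]) (thead v))
| recursive_mu k (g : k.+1.-tuple nat -> nat)
    (g_regular : forall v : k.-tuple nat, exists n, g [tuple of n :: v] == 0%N) :
    recursive g -> @recursive k (fun v => ex_minn (g_regular v)).

Definition situation := seq bool.

(* [omega n] is the entry of index n + 1, so that the initial segment of
   length n is [mkseq omega n]. *)
Definition binary_path := nat -> bool.

(* Bijective base-2 numeration. *)
Definition situation_code (s : situation) : nat :=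
  foldl (fun m (x : bool) => (m.*2 + x.+1)%N) 0%N s.

Lemma situation_code_rcons s x :
  situation_code (rcons s x) = ((situation_code s).*2 + x.+1)%N.
Proof. by rewrite /situation_code -cats1 foldl_cat. Qed.

Lemma situation_code_bij : bijective situation_code.
Proof.
have inj : injective situation_code.
  elim/last_ind => [|s x IH] t; case/lastP: t => [|t y] //;
    rewrite ?situation_code_rcons ?addnS //.
  move=> [] e.
  have exy : x = y by move/(congr1 odd): e; rewrite !oddD !odd_double !oddb.
  move: e; rewrite exy => /addIn/double_inj /IH -> //.
have surj n : exists s, situation_code s = n.
  elim/ltn_ind: n => -[|n] IH; first by exists [::].
  have /IH[s es] : (n./2 < n.+1)%N by rewrite ltnS leq_half_double leqW // -addnn leq_addr.
  exists (rcons s (odd n)).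
  by rewrite situation_code_rcons es addnS addnC odd_double_half.
have [g gP] := choice surj.
by exists g => // s; apply: inj; rewrite gP.
Qed.

Definition recursive_rationals (r : situation -> nat -> rat) : Prop :=
  exists sgn num den : 2.-tuple nat -> nat,
    [/\ recursive sgn, recursive num, recursive den &
      forall (s : situation) (n : nat),
        let v := [tuple situation_code s; n] in
        den v <> 0%N /\
        r s n = (-1) ^+ sgn v * (num v)%:R / (den v)%:R].

Section Forecasts.
Variable R : realType.

Record interval_forecast := IntervalForecast {
  forecast_set :> set R;
  forecast_setP : exists a b : R,
    [/\ 0 <= a, a <= b, b <= 1 & forecast_set = [set` `[a, b]]] }.

Definition upper_expectation (I : set R) (f : bool -> R) : R :=
  sup [set p * f true + (1 - p) * f false | p in I].

Lemma upper_expectation_max (I : interval_forecast) (f : bool -> R) :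
  (exists2 p, forecast_set I p & upper_expectation I f = p * f true + (1 - p) * f false) /\
  (forall p, forecast_set I p -> p * f true + (1 - p) * f false <= upper_expectation I f).
Proof.
case: I => I /= [a [b [a0 ab b1 IE]]].
pose g p := p * f true + (1 - p) * f false.
have gB p q : g q - g p = (q - p) * (f true - f false).
  by rewrite /g !mulrBl !mulrBr !mul1r; ring.
have [p Ip pmax] : exists2 p, I p & forall q, I q -> g q <= g p.
  have [fle|flt] := lerP (f false) (f true).
    exists b; first by rewrite IE /= in_itv /= ab lexx.
    move=> q; rewrite IE /= in_itv /= => /andP[_ qb].
    by rewrite -subr_ge0 gB mulr_ge0 ?subr_ge0.
  exists a; first by rewrite IE /= in_itv /= ab lexx.
  move=> q; rewrite IE /= in_itv /= => /andP[aq _].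
  by rewrite -subr_ge0 gB mulr_le0 ?subr_le0 // ltW.
have E : upper_expectation I f = g p.
  apply/eqP; rewrite eq_le; apply/andP; split.
    apply: ge_sup; first by exists (g p); exists p.
    by move=> _ [q Iq <-]; exact: pmax.
  apply: ub_le_sup; last by exists p.
  by exists (g p) => _ [q Iq <-]; exact: pmax.
by split; [exists p | move=> q Iq; rewrite E; exact: pmax].
Qed.

Definition forecasting_system := situation -> interval_forecast.

Definition stationary (I : interval_forecast) : forecasting_system := fun=> I.

Definition real_process := situation -> R.

Definition process_difference (F : real_process) (s : situation) (x : bool) : R :=
  F (rcons s x) - F s.

Definition test_process (F : real_process) : Prop :=
  F [::] = 1 /\ forall s, 0 <= F s.

Definition supermartingale (phi : forecasting_system) (M : real_process) : Prop :=
  forall s, upper_expectation (phi s) (process_difference M s) <= 0.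

Definition test_supermartingale (phi : forecasting_system) (T : real_process) :
    Prop :=
  test_process T /\ supermartingale phi T.

Definition lower_semicomputable (F : real_process) : Prop :=
  exists r : situation -> nat -> rat,
    [/\ recursive_rationals r,
        forall s, nondecreasing_seq (r s) &
        forall s, (fun n => ratr (r s n) : R) @ \oo --> F s].

Definition multiplier_process (D : situation -> bool -> R) : Prop :=
  forall s x, 0 <= D s x.

Definition lower_semicomputable_multiplier (D : situation -> bool -> R) : Prop :=
  lower_semicomputable (D^~ false) /\ lower_semicomputable (D^~ true).

Definition generated_process (D : situation -> bool -> R) : real_process :=
  fun s => \prod_(i < size s) D (take i s) (nth false s i).

Lemma generated_process_nil D : generated_process D [::] = 1.
Proof. by rewrite /generated_process big_ord0. Qed.

Lemma generated_process_rcons D s x :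
  generated_process D (rcons s x) = generated_process D s * D s x.
Proof.
rewrite /generated_process size_rcons big_ord_recr /= nth_rcons ltnn eqxx.
rewrite -!cats1 take_size_cat //; congr (_ * _); apply: eq_bigr => i _.
by rewrite cats1 nth_rcons ltn_ord -cats1 takel_cat // ltnW.
Qed.

Definition ML_generated_processes : set real_process :=
  [set T | exists D : situation -> bool -> R,
    [/\ multiplier_process D, lower_semicomputable_multiplier D &
        T = generated_process D]].

Definition weakly_ML_random (phi : forecasting_system) (omega : binary_path) :
    Prop :=
  forall T, ML_generated_processes T -> test_supermartingale phi T ->
    (ereal_sup [set (T (mkseq omega n))%:E | n in [set n | (0 < n)%N]] < +oo)%E.

Definition weakly_ML_forecasts (omega : binary_path) : set interval_forecast :=
  [set I | weakly_ML_random (stationary I) omega].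

End Forecasts.

(* Main.v *)
(* A lower semicomputable multiplier [D] factors as a product of two lower
   semicomputable multipliers, [(max 1 D(1), min 1 D(0))] betting on ones and
   [(min 1 D(1), max 1 D(0))] betting on zeros. If [D] is fair for the interval
   [I `&` J], fairness of the first factor only needs the upper endpoint of
   [I `&` J], which is that of [I] or of [J], and fairness of the second only its
   lower endpoint; hence both generated processes are bounded along the path,
   and so is their product. If [I] lies strictly below [J], constant bets on ones
   (fair for [I]) and on zeros (fair for [J]) at rational odds taken in the gap
   generate processes whose product grows exponentially along every path. *)

Require Import Defs.
From mathcomp Require Import all_boot all_order all_algebra.
From mathcomp Require Import all_classical all_reals all_analysis.
From mathcomp Require Import zify ring lra.

Set Implicit Arguments.
Unset Strict Implicit.
Unset Printing Implicit Defensive.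

Import Order.TTheory GRing.Theory Num.Theory.
Import numFieldNormedType.Exports.

Local Open Scope classical_set_scope.

Lemma recursive_ext k (f g : k.-tuple nat -> nat) :
  f =1 g -> recursive f -> recursive g.
Proof. by move=> /funext ->. Qed.

Lemma recursive_thead k : recursive (fun w : k.+1.-tuple nat => thead w).
Proof. exact: recursive_proj. Qed.

Lemma recursive_behead k (f : k.-tuple nat -> nat) :
  recursive f -> recursive (fun w : k.+1.-tuple nat => f [tuple of behead w]).
Proof.
move=> rf.
apply: recursive_ext (recursive_comp rf (fun i => recursive_proj (lift ord0 i))).
move=> w; congr f; apply: eq_from_tnth => i.
by rewrite tnth_mktuple !(tnth_nth 0%N) nth_behead lift0.
Qed.

Lemma recursive_comp1 k (g : 1.-tuple nat -> nat) (f : k.-tuple nat -> nat) :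
  recursive g -> recursive f -> recursive (fun v => g [tuple f v]).
Proof.
move=> rg rf; apply: recursive_ext (recursive_comp rg (fun=> rf)) => v.
by congr g; apply: eq_from_tnth => i; rewrite tnth_mktuple (ord1 i).
Qed.

Lemma recursive_comp2 k (g : 2.-tuple nat -> nat) (f1 f2 : k.-tuple nat -> nat) :
  recursive g -> recursive f1 -> recursive f2 ->
  recursive (fun v => g [tuple f1 v; f2 v]).
Proof.
move=> rg rf1 rf2.
pose h (i : 'I_2) := if i == ord0 then f1 else f2.
have rh i : recursive (h i) by rewrite /h; case: ifP.
apply: recursive_ext (recursive_comp rg rh) => v; congr g.
apply: eq_from_tnth => i; rewrite tnth_mktuple /h.
by case: i => -[|[|//]] ?.
Qed.

Lemma recursive_S k (f : k.-tuple nat -> nat) :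
  recursive f -> recursive (fun v => (f v).+1).
Proof. by move=> rf; apply: recursive_comp1 recursive_succ rf. Qed.

Lemma recursive_const k c : recursive (fun _ : k.-tuple nat => c).
Proof. by elim: c => [|c /recursive_S //]; exact: recursive_zero. Qed.

Lemma recursive_nat_rect k (n g : k.-tuple nat -> nat)
    (h : nat -> nat -> k.-tuple nat -> nat) :
  recursive n -> recursive g ->
  recursive (fun w : k.+2.-tuple nat =>
    h (thead w) (thead [tuple of behead w]) [tuple of behead (behead w)]) ->
  recursive (fun v => nat_rect (fun=> nat) (g v) (fun i y => h i y v) (n v)).
Proof.
move=> rn rg rh.
pose H (i : 'I_k.+1) (v : k.-tuple nat) :=
  if unlift ord0 i is Some j then tnth v j else n v.
have rH i : recursive (H i).
  by rewrite /H; case: unlift => [j|] //; exact: recursive_proj.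
apply: recursive_ext (recursive_comp (recursive_prim rg rh) rH) => v.
have -> : [tuple H i v | i < k.+1] = [tuple of n v :: v].
  apply: eq_from_tnth => i; rewrite tnth_mktuple /H.
  by case: unliftP => [j ->|->]; rewrite ?tnthS.
rewrite /= theadE.
have -> : [tuple of behead [tuple of n v :: v]] = v by exact: val_inj.
congr nat_rect; apply/funext => i; apply/funext => y.
by congr h; apply: val_inj.
Qed.

Lemma recursive_if k (c f g : k.-tuple nat -> nat) :
  recursive c -> recursive f -> recursive g ->
  recursive (fun v => if c v == 0%N then g v else f v).
Proof.
move=> rc rf rg.
apply: recursive_ext (@recursive_nat_rect _ c g (fun _ _ v => f v) rc rg _).
  by move=> v; case: (c v).
exact: (recursive_behead (recursive_behead rf)).
Qed.

Lemma recursive_pred k (f : k.-tuple nat -> nat) :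
  recursive f -> recursive (fun v => (f v).-1).
Proof.
move=> rf.
apply: recursive_ext (@recursive_nat_rect _ f (fun=> 0%N) (fun i _ _ => i) rf
  (recursive_const _ _) (recursive_thead _)).
by move=> v; case: (f v).
Qed.

Lemma recursive_snd k : recursive (fun w : k.+2.-tuple nat => thead [tuple of behead w]).
Proof. exact: recursive_behead (recursive_thead _). Qed.

Lemma recursive_add k (f g : k.-tuple nat -> nat) :
  recursive f -> recursive g -> recursive (fun v => f v + g v)%N.
Proof.
move=> rf rg.
apply: recursive_ext (@recursive_nat_rect _ f g (fun _ y _ => y.+1) rf rg
  (recursive_S (recursive_snd _))).
by move=> v; elim: (f v) => //= n ->.
Qed.

Lemma recursive_sub k (f g : k.-tuple nat -> nat) :
  recursive f -> recursive g -> recursive (fun v => f v - g v)%N.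
Proof.
move=> rf rg.
apply: recursive_ext (@recursive_nat_rect _ g f (fun _ y _ => y.-1) rg rf
  (recursive_pred (recursive_snd _))).
by move=> v; elim: (g v) => [|n /= ->]; rewrite ?subn0 ?subnS.
Qed.

Lemma recursive_odd k (f : k.-tuple nat -> nat) :
  recursive f -> recursive (fun v => nat_of_bool (odd (f v))).
Proof.
move=> rf.
apply: recursive_ext (@recursive_nat_rect _ f (fun=> 0%N) (fun _ y _ => 1 - y)%N rf
  (recursive_const _ _) (recursive_sub (recursive_const _ 1) (recursive_snd _))).
by move=> v; elim: (f v) => [|n /= ->] //=; case: odd.
Qed.

Lemma recursive_half k (f : k.-tuple nat -> nat) :
  recursive f -> recursive (fun v => (f v)./2).
Proof.
move=> rf.
apply: recursive_ext (@recursive_nat_rect _ f (fun=> 0%N)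
  (fun i y _ => odd i + y)%N rf (recursive_const _ _) _).
  by move=> v; elim: (f v) => [|n /= ->] //=; rewrite uphalf_half.
apply: recursive_add (recursive_snd _).
exact: recursive_odd (recursive_thead _).
Qed.

Definition recursive_relation (P : situation -> nat -> bool) :=
  exists2 c : 2.-tuple nat -> nat, recursive c &
    forall s n, P s n = (c [tuple situation_code s; n] != 0%N).

(* On codes, [rcons s x] is sent to [s] and the root [0] is its own parent. *)
Definition parent_code (m : nat) : nat := m.-1./2.

Lemma parent_code_rcons s x :
  parent_code (situation_code (rcons s x)) = situation_code s.
Proof. by rewrite /parent_code situation_code_rcons; case: x; lia. Qed.

Lemma size_situation_code s : (size s <= situation_code s)%N.
Proof.
elim/last_ind: s => // s x IH; rewrite size_rcons situation_code_rcons.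
by lia.
Qed.

Lemma recursive_iter_parent k (f g : k.-tuple nat -> nat) :
  recursive f -> recursive g ->
  recursive (fun v => iter (f v) parent_code (g v)).
Proof.
move=> rf rg.
apply: recursive_ext (@recursive_nat_rect _ f g (fun _ y _ => parent_code y) rf rg
  (recursive_half (recursive_pred (recursive_snd _)))).
by move=> v; elim: (f v) => [|n /= ->].
Qed.

Lemma recursive_relation_prefixes (P : bool -> situation -> nat -> bool) :
  (forall x, recursive_relation (P x)) ->
  recursive_relation (fun s n =>
    all (fun i => P (nth false s i) (take i s) n) (iota 0 (size s))).
Proof.
move=> rP.
have [c0 rc0 c0P] := rP false; have [c1 rc1 c1P] := rP true.
pose good n j := if j == 0%N then 1%N else
  if (odd j.-1 : nat) == 0%N then c0 [tuple parent_code j; n]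
  else c1 [tuple parent_code j; n].
have good_rcons s x n : (good n (situation_code (rcons s x)) != 0%N) = P x s n.
  rewrite /good parent_code_rcons situation_code_rcons addnS /= oddD odd_double.
  by case: x => /=; rewrite -?c0P -?c1P.
pose step n m i y := if y == 0%N then 0%N else good n (iter i parent_code m).
pose c (v : 2.-tuple nat) :=
  nat_rect (fun=> nat) 1%N (step (tnth v ord_max) (thead v)) (thead v).
have cE n m k : (nat_rect (fun=> nat) 1%N (step n m) k != 0%N) =
    all (fun i => good n (iter i parent_code m) != 0%N) (iota 0 k).
  elim: k => // k IH; rewrite -[in RHS]addn1 iotaD all_cat -IH /= andbT add0n /step.
  by case: (nat_rect _ _ _ k).
have allE n s k : (size s <= k)%N ->
    all (fun i => good n (iter i parent_code (situation_code s)) != 0%N) (iota 0 k) =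
    all (fun i => P (nth false s i) (take i s) n) (iota 0 (size s)).
  elim/last_ind: s k => [|s x IH] k; first by move=> _; apply/allP => i _; rewrite iter_fix.
  rewrite size_rcons; case: k => // k sk.
  rewrite [LHS]/= -[1%N]addn0 iotaDl all_map good_rcons.
  rewrite -[in RHS]addn1 iotaD all_cat /= andbT add0n.
  rewrite nth_rcons ltnn eqxx -cats1 take_size_cat // cats1 andbC.
  congr (_ && _).
  rewrite -(eq_all (a1 := fun i =>
    good n (iter i parent_code (situation_code s)) != 0%N)); last first.
    by move=> i; rewrite /= -iterS iterSr parent_code_rcons.
  rewrite IH //; apply: eq_in_all => i; rewrite mem_iota /= add0n => si.
  by rewrite nth_rcons si -cats1 takel_cat // ltnW.
exists c; last by move=> s n; rewrite /c theadE cE allE // size_situation_code.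
have rm : recursive (fun w : 4.-tuple nat => iter (thead w) parent_code (tnth w (inord 2))).
  by apply: recursive_iter_parent; exact: recursive_proj.
have rn : recursive (fun w : 4.-tuple nat => tnth w ord_max) by exact: recursive_proj.
have rp := recursive_half (recursive_pred rm).
apply: recursive_nat_rect; [exact: recursive_proj|exact: recursive_const|].
apply: recursive_ext (recursive_if (recursive_snd 2)
  (recursive_if rm (recursive_if (recursive_odd (recursive_pred rm))
     (recursive_comp2 rc1 rp rn) (recursive_comp2 rc0 rp rn)) (recursive_const _ 1))
  (recursive_const _ 0)).
move=> w; rewrite /step /good.
have -> : tnth w (inord 2) = thead [tuple of behead (behead w)].
  by rewrite (tuple_eta w) (tnth_nth 0%N) inordK //; case: w => -[|a [|b [|d []]]].
have -> // : tnth w ord_max = tnth [tuple of behead (behead w)] ord_max.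
by rewrite !(tnth_nth 0%N) /= !nth_behead.
Qed.

Local Open Scope ring_scope.

Lemma recursive_relation_and (P Q : situation -> nat -> bool) :
  recursive_relation P -> recursive_relation Q ->
  recursive_relation (fun s n => P s n && Q s n).
Proof.
move=> [c rc cP] [d rd dP].
exists (fun v => if c v == 0%N then 0%N else d v).
  exact: recursive_if rc rd (recursive_const _ _).
by move=> s n; rewrite cP dP; case: (c _).
Qed.

Lemma recursive_relation_lt1 (r : situation -> nat -> rat) :
  recursive_rationals r -> recursive_relation (fun s n => r s n < 1).
Proof.
move=> [sgn [num [den [rs rn rd rE]]]].
exists (fun v => if odd (sgn v) == 0%N :> nat then (den v - num v)%N else 1%N).
  exact: recursive_if (recursive_odd rs) (recursive_const _ _) (recursive_sub rd rn).
move=> s n; have /= [/eqP d0 ->] := rE s n.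
set v := [tuple _; _] in d0 *.
have d_gt0 : 0 < (den v)%:R :> rat by rewrite ltr0n lt0n.
rewrite ltr_pdivrMr // mul1r -signr_odd; case: odd => /=.
  by rewrite expr1 mulN1r (le_lt_trans _ d_gt0) // oppr_le0.
by rewrite expr0 mul1r ltr_nat -lt0n subn_gt0.
Qed.

Lemma recursive_relation_gt0 (r : situation -> nat -> rat) :
  recursive_rationals r -> recursive_relation (fun s n => 0 < r s n).
Proof.
move=> [sgn [num [den [rs rn rd rE]]]].
exists (fun v => if odd (sgn v) == 0%N :> nat then num v else 0%N).
  exact: recursive_if (recursive_odd rs) (recursive_const _ _) rn.
move=> s n; have /= [/eqP d0 ->] := rE s n.
set v := [tuple _; _] in d0 *.
have d_gt0 : 0 < (den v)%:R :> rat by rewrite ltr0n lt0n.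
rewrite pmulr_lgt0 ?invr_gt0 // -signr_odd; case: odd => /=.
  by rewrite expr1 mulN1r oppr_gt0 ltrn0.
by rewrite expr0 mul1r ltr0n lt0n.
Qed.

Lemma recursive_rationals_const (q : rat) : recursive_rationals (fun _ _ => q).
Proof.
exists (fun=> nat_of_bool (numq q < 0)), (fun=> `|numq q|%N), (fun=> `|denq q|%N).
split; [exact: recursive_const..|] => s n v; split.
  by apply/eqP; rewrite absz_eq0 denq_neq0.
rewrite -[LHS]divq_num_den; congr (_ / _).
  rewrite {1}[numq q]intEsign rmorphM rmorphXn rmorphN1.
  by [].
by rewrite -{1}absz_denq.
Qed.

Lemma recursive_rationals_if (P : situation -> nat -> bool)
    (r t : situation -> nat -> rat) :
  recursive_relation P -> recursive_rationals r -> recursive_rationals t ->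
  recursive_rationals (fun s n => if P s n then r s n else t s n).
Proof.
move=> [c rc cP] [sr [nr [dr [rsr rnr rdr rE]]]] [st [nt [dt [rst rnt rdt tE]]]].
exists (fun v => if c v == 0%N then st v else sr v),
  (fun v => if c v == 0%N then nt v else nr v),
  (fun v => if c v == 0%N then dt v else dr v).
split; [exact: recursive_if..|] => s n v.
by rewrite cP -/v; case: eqP => _ /=; [exact: tE | exact: rE].
Qed.

Lemma lower_semicomputable_const (R : realType) (q : rat) :
  lower_semicomputable (fun _ => ratr q : R).
Proof.
exists (fun _ _ => q); split; [exact: recursive_rationals_const | by move=> s m n _ |].
by move=> s; exact: cvg_cst.
Qed.

Lemma lower_semicomputable_max1 (R : realType) (F : real_process R) :
  lower_semicomputable F -> lower_semicomputable (fun s => Num.max 1 (F s)).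
Proof.
move=> [r [rr r_nd rF]]; exists (fun s n => Num.max 1 (r s n)); split.
- suff -> : (fun s n => Num.max 1 (r s n)) = (fun s n => if r s n < 1 then 1 else r s n).
    apply: recursive_rationals_if => //; first exact: recursive_relation_lt1.
    exact: recursive_rationals_const.
  by apply/funext => s; apply/funext => n; rewrite maxC.
- by move=> s m n /(r_nd s) le_r; exact: le_max2.
- move=> s; under eq_fun do rewrite maxr_rat rmorph1.
  apply: (cvg_comp _ (fun y : R => Num.max 1 y) (rF s)).
  by apply: (@continuous_max _ _ (cst 1) id); [exact: cvg_cst | exact: cvg_id].
Qed.

Lemma lower_semicomputable_min1 (R : realType) (F : real_process R) :
  lower_semicomputable F -> lower_semicomputable (fun s => Num.min 1 (F s)).
Proof.
move=> [r [rr r_nd rF]]; exists (fun s n => Num.min 1 (r s n)); split.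
- suff -> : (fun s n => Num.min 1 (r s n)) = (fun s n => if r s n < 1 then r s n else 1).
    apply: recursive_rationals_if => //; first exact: recursive_relation_lt1.
    exact: recursive_rationals_const.
  by apply/funext => s; apply/funext => n; rewrite minC.
- by move=> s m n /(r_nd s) le_r; exact: le_min2.
- move=> s; under eq_fun do rewrite minr_rat rmorph1.
  apply: (cvg_comp _ (fun y : R => Num.min 1 y) (rF s)).
  by apply: (@continuous_min _ _ (cst 1) id); [exact: cvg_cst | exact: cvg_id].
Qed.

Lemma generated_process_ge0 (R : realType) (D : situation -> bool -> R) s :
  multiplier_process D -> 0 <= generated_process D s.
Proof. by move=> D0; apply: prodr_ge0. Qed.

Lemma generated_processM (R : realType) (D E : situation -> bool -> R) s :
  generated_process (fun s x => D s x * E s x) s =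
  generated_process D s * generated_process E s.
Proof. exact: big_split. Qed.

(* [trim D] generates the same process as [D], but satisfies the
   supermartingale inequality also in the situations where that process is 0. *)
Definition trim (R : realType) (D : situation -> bool -> R) s x : R :=
  if 0 < generated_process D s then D s x else 0.

Lemma trim_ge0 (R : realType) (D : situation -> bool -> R) :
  multiplier_process D -> multiplier_process (trim D).
Proof. by move=> D0 s x; rewrite /trim; case: ifP. Qed.

Lemma generated_process_trim (R : realType) (D : situation -> bool -> R) s :
  multiplier_process D -> generated_process (trim D) s = generated_process D s.
Proof.
move=> D0; elim/last_ind: s => [|s x IH]; first by rewrite !generated_process_nil.
rewrite !generated_process_rcons IH /trim.
have := generated_process_ge0 s D0; rewrite le_eqVlt => /predU1P[<-|->] //.
by rewrite !mul0r.
Qed.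

Lemma lower_semicomputable_trim (R : realType) (D : situation -> bool -> R) :
  multiplier_process D -> lower_semicomputable_multiplier D ->
  lower_semicomputable_multiplier (trim D).
Proof.
move=> D0 [[r0 [rr0 r0_nd r0D]] [r1 [rr1 r1_nd r1D]]].
pose r (x : bool) := if x then r1 else r0.
have rr x : recursive_rationals (r x) by case: x.
have r_nd x s : nondecreasing_seq (r x s) by case: x.
have rD x s : (ratr (r x s n) : R) @[n --> \oo] --> D s x by case: x.
have r_le x s n : ratr (r x s n) <= D s x.
  rewrite -(cvg_lim (@Rhausdorff R) (rD x s)).
  apply: (@nondecreasing_cvgn_le _ (fun n => ratr (r x s n) : R)) => [i j ij|].
    by rewrite ler_rat r_nd.
  by apply/cvg_ex; exists (D s x).
suff lsc x : lower_semicomputable ((trim D)^~ x) by split.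
pose live s n := all (fun i => 0 < r (nth false s i) (take i s) n) (iota 0 (size s)).
have live_nd s m n : (m <= n)%N -> live s m -> live s n.
  by move=> mn /allP l; apply/allP => i /l /lt_le_trans; apply; exact: r_nd.
exists (fun s n => if live s n && (0 < r x s n) then r x s n else 0); split.
- apply: recursive_rationals_if => //; last exact: recursive_rationals_const.
  apply: recursive_relation_and; last exact: recursive_relation_gt0.
  apply: (@recursive_relation_prefixes (fun y s n => 0 < r y s n)) => y.
  exact: recursive_relation_gt0.
- move=> s m n mn; case: ifPn => [/andP[lm rm]|_]; last by case: ifP => // /andP[_ /ltW].
  by rewrite (live_nd _ _ _ mn lm) (lt_le_trans rm) ?r_nd.
move=> s; rewrite /trim; case: ltP => [gen_gt0|gen_le0]; last first.
  apply: cvg_near_cst; near=> n; case: ifP => [/andP[/allP l _]|_]; last exact: rmorph0.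
  have : generated_process D s == 0.
    by rewrite eq_le gen_le0 generated_process_ge0.
  rewrite /generated_process prodf_seq_eq0 => /hasP[i _ /eqP Di0].
  have /l : (i : nat) \in iota 0 (size s) by rewrite mem_iota ltn_ord.
  by rewrite -(ltr0q R) ltNge -Di0 r_le.
have Ds_gt0 (i : 'I_(size s)) : 0 < D (take i s) (nth false s i).
  rewrite lt_neqAle D0 andbT eq_sym.
  by move: (lt0r_neq0 gen_gt0); rewrite /generated_process => /prodf_neq0 /(_ i isT).
have live_near : \forall n \near \oo, live s n.
  have : \forall n \near \oo, forall i : 'I_(size s), 0 < r (nth false s i) (take i s) n.
    apply: filter_forall => i; near=> n; rewrite -(ltr0q R); near: n.
    exact: cvgr_gt (rD _ _) _ (Ds_gt0 i).
  apply: filterS => n Hn; apply/allP => i; rewrite mem_iota add0n /= => si.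
  exact: (Hn (Ordinal si)).
have [Dx0|Dx_neq0] := eqVneq (D s x) 0.
  rewrite Dx0; apply: cvg_near_cst; near=> n.
  case: ifP => [/andP[_]|_]; last exact: rmorph0.
  by rewrite -(ltr0q R) ltNge -Dx0 r_le.
have Dx_gt0 : 0 < D s x by rewrite lt_neqAle eq_sym Dx_neq0 D0.
apply: cvg_trans (rD x s); apply: near_eq_cvg; near=> n.
have -> : live s n by near: n.
have -> // : 0 < r x s n.
by rewrite -(ltr0q R); near: n; exact: cvgr_gt (rD _ _) _ Dx_gt0.
Unshelve. all: by end_near. Qed.

Lemma generated_test_supermartingale (R : realType) (I : interval_forecast R)
    (D : situation -> bool -> R) :
  multiplier_process D ->
  (forall s p, forecast_set I p -> p * D s true + (1 - p) * D s false <= 1) ->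
  test_supermartingale (stationary I) (generated_process D).
Proof.
move=> D0 DI; split; first split; [exact: generated_process_nil | |].
  by move=> s; exact: generated_process_ge0.
move=> s; have [[p Ip ->] _] :=
  upper_expectation_max I (process_difference (generated_process D) s).
rewrite /process_difference !generated_process_rcons.
set T := generated_process D s.
have -> : p * (T * D s true - T) + (1 - p) * (T * D s false - T) =
  T * (p * D s true + (1 - p) * D s false - 1) by ring.
by rewrite mulr_ge0_le0 ?generated_process_ge0 // subr_le0 DI.
Qed.

Lemma supermartingale_trim (R : realType) (I : interval_forecast R)
    (D : situation -> bool -> R) :
  supermartingale (stationary I) (generated_process D) ->
  forall s p, forecast_set I p -> p * trim D s true + (1 - p) * trim D s false <= 1.
Proof.
move=> sD s p Ip; rewrite /trim; case: ltP => [T_gt0|_]; last by rewrite !mulr0 addr0.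
have [_ /(_ p Ip)] :=
  upper_expectation_max I (process_difference (generated_process D) s).
move/le_trans/(_ (sD s)); rewrite /process_difference !generated_process_rcons.
set T := generated_process D s in T_gt0 *.
have -> : p * (T * D s true - T) + (1 - p) * (T * D s false - T) =
  T * (p * D s true + (1 - p) * D s false - 1) by ring.
by rewrite pmulr_rle0 // subr_le0.
Qed.

Lemma weakly_ML_forecasts_bounded (R : realType) (omega : binary_path)
    (I : interval_forecast R) (D : situation -> bool -> R) :
  weakly_ML_forecasts omega I ->
  multiplier_process D -> lower_semicomputable_multiplier D ->
  (forall s p, forecast_set I p -> p * D s true + (1 - p) * D s false <= 1) ->
  exists B : R, forall n, (0 < n)%N -> generated_process D (mkseq omega n) <= B.
Proof.
move=> Iomega D0 lscD DI.
move: (Iomega (generated_process D)).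
move=> /(_ (ex_intro _ D (And3 D0 lscD erefl)) (generated_test_supermartingale D0 DI)).
set S := [set _ | _ in _] => supS.
have ubS n : (0 < n)%N -> ((generated_process D (mkseq omega n))%:E <= ereal_sup S)%E.
  by move=> n0; apply: ereal_sup_ubound; exists n.
case: (ereal_sup S) supS ubS => [B _ ubS|//|_ /(_ 1 isT) //].
by exists B => n /ubS; rewrite lee_fin.
Qed.

(* Since [max 1 y * min 1 y = y], the processes [bet true D] and [bet false D]
   factor [D]; the first bets only on ones and the second only on zeros, so
   that their supermartingale inequalities involve a single endpoint each. *)
Definition bet (R : realType) (b : bool) (D : situation -> bool -> R) s x : R :=
  if x == b then Num.max 1 (D s x) else Num.min 1 (D s x).

Lemma bet_ge0 (R : realType) b (D : situation -> bool -> R) :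
  multiplier_process D -> multiplier_process (bet b D).
Proof.
move=> D0 s x; rewrite /bet; case: ifP => _; first by rewrite le_max ler01.
by rewrite le_min ler01 D0.
Qed.

Lemma lower_semicomputable_bet (R : realType) b (D : situation -> bool -> R) :
  lower_semicomputable_multiplier D -> lower_semicomputable_multiplier (bet b D).
Proof.
by move=> [lsc0 lsc1]; case: b; split; rewrite /bet /=;
  by [apply: lower_semicomputable_max1 | apply: lower_semicomputable_min1].
Qed.

Lemma generated_process_bet (R : realType) (D : situation -> bool -> R) s :
  generated_process (bet true D) s * generated_process (bet false D) s =
  generated_process D s.
Proof.
rewrite -generated_processM; congr (generated_process _ s).
apply/funext => {}s; apply/funext => x; rewrite /bet.
by case: x => /=; case: (lerP 1 (D s _)) => _; rewrite ?mul1r ?mulr1.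
Qed.

Lemma mean_max_min_le1 (R : realType) (p q x y : R) :
  0 <= p -> p <= q -> q <= 1 -> q * x + (1 - q) * y <= 1 ->
  p * Num.max 1 x + (1 - p) * Num.min 1 y <= 1.
Proof.
move=> p0 pq q1 xy; set u := Num.max 1 x; set v := Num.min 1 y.
have u1 : 1 <= u by rewrite le_max lexx.
have v1 : v <= 1 by rewrite ge_min lexx.
have vy : v <= y by rewrite ge_min lexx orbT.
have : 0 <= (q - p) * (u - v) by rewrite mulr_ge0 ?subr_ge0 // (le_trans v1).
have [ux|ux] : u = 1 \/ u = x by rewrite /u; case: leP; [right|left].
  have : 0 <= (1 - q) * (1 - v) by rewrite mulr_ge0 ?subr_ge0.
  rewrite ux; nra.
have : 0 <= (1 - q) * (y - v) by rewrite mulr_ge0 ?subr_ge0.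
rewrite ux; nra.
Qed.

Lemma bet_true_le1 (R : realType) (D : situation -> bool -> R) s (p q : R) :
  0 <= p -> p <= q -> q <= 1 -> q * D s true + (1 - q) * D s false <= 1 ->
  p * bet true D s true + (1 - p) * bet true D s false <= 1.
Proof. exact: mean_max_min_le1. Qed.

Lemma bet_false_le1 (R : realType) (D : situation -> bool -> R) s (p q : R) :
  p <= 1 -> q <= p -> 0 <= q -> q * D s true + (1 - q) * D s false <= 1 ->
  p * bet false D s true + (1 - p) * bet false D s false <= 1.
Proof.
move=> p1 qp q0 qD; rewrite addrC -{2}[p](subKr 1).
apply: (@mean_max_min_le1 _ _ (1 - q)); rewrite ?subr_ge0 ?lerD2l ?lerN2 //.
  by rewrite gerBl.
by rewrite subKr addrC.
Qed.

Lemma bernoulli_inequality (R : realType) (e : R) n : 0 <= e -> 1 + n%:R * e <= (1 + e) ^+ n.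
Proof.
move=> e0; elim: n => [|n IH]; first by rewrite mul0r addr0.
rewrite exprS mulrDl mul1r -natr1.
have : 0 <= e * ((1 + e) ^+ n - 1) by rewrite mulr_ge0 // subr_ge0 exprn_ege1 // lerDl.
lra.
Qed.

Lemma weakly_ML_forecasts_le (R : realType) (omega : binary_path)
    (I J : interval_forecast R) (b c : R) :
  weakly_ML_forecasts omega I -> weakly_ML_forecasts omega J ->
  (forall p, forecast_set I p -> p <= b) -> (forall p, forecast_set J p -> c <= p) ->
  0 <= b -> c <= 1 -> c <= b.
Proof.
move=> Iomega Jomega Ib Jc b0 c1; rewrite leNgt; apply/negP => bc.
have [q1 /[!in_itv] /andP[bq1 q1c]] := rat_in_itvoo bc.
have [q2 /[!in_itv] /andP[q12 q2c]] := rat_in_itvoo q1c.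
have q1_gt0 : 0 < q1 by rewrite -(ltr0q R) (le_lt_trans b0).
have q2_lt1 : q2 < 1 by rewrite -(ltr_rat R) rmorph1 (lt_le_trans q2c).
have {}q12 : q1 < q2 by rewrite -(ltr_rat R).
have [e [e_gt0 e_lt1 q2E]] : exists e : rat, [/\ 0 < e, e < 1 & q2 = q1 + 2 * e].
  by exists ((q2 - q1) / 2); split; [lra | lra | field].
(* The second-order terms of the product of the two bets are dominated by the
   gain [e * (q2 - q1) = 2 * e ^+ 2], which does not depend on the outcome. *)
pose D (_ : situation) x : rat := if x then 1 + e * (1 - q1) else 1 - e * q1.
pose E (_ : situation) x : rat := if x then 1 - e * (1 - q2) else 1 + e * q2.
have D0 s x : 0 <= D s x by rewrite /D; case: x => /=; nra.
have E0 s x : 0 <= E s x by rewrite /E; case: x => /=; nra.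
have DE s x : 1 + e ^+ 2 <= D s x * E s x.
  rewrite -subr_ge0 /D /E; case: x.
    have -> : (1 + e * (1 - q1)) * (1 - e * (1 - q2)) - (1 + e ^+ 2) =
      e ^+ 2 * (1 - (1 - q1) * (1 - q2)) by rewrite q2E; ring.
    by rewrite mulr_ge0 ?sqr_ge0 // subr_ge0 mulr_ile1 ?subr_ge0; lra.
  have -> : (1 - e * q1) * (1 + e * q2) - (1 + e ^+ 2) =
    e ^+ 2 * (1 - q1 * q2) by rewrite q2E; ring.
  by rewrite mulr_ge0 ?sqr_ge0 // subr_ge0 mulr_ile1 ?subr_ge0; lra.
pose DR s x : R := ratr (D s x); pose ER s x : R := ratr (E s x).
have DR0 : multiplier_process DR by move=> s x; rewrite ler0q.
have ER0 : multiplier_process ER by move=> s x; rewrite ler0q.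
have eR_gt0 : 0 < ratr e :> R by rewrite ltr0q.
have [||A DA] := weakly_ML_forecasts_bounded Iomega DR0.
- by split; exact: lower_semicomputable_const.
- move=> s p /Ib pb; rewrite /DR /D !(rmorphD, rmorphB, rmorphN, rmorphM, rmorph1).
  have : 0 <= ratr e * (ratr q1 - p) by rewrite mulr_ge0 ?ltW // subr_gt0 (le_lt_trans pb).
  lra.
have [||B EB] := weakly_ML_forecasts_bounded Jomega ER0.
- by split; exact: lower_semicomputable_const.
- move=> s p /Jc cp; rewrite /ER /E !(rmorphD, rmorphB, rmorphN, rmorphM, rmorph1).
  have : 0 <= ratr e * (p - ratr q2) by rewrite mulr_ge0 ?ltW // subr_gt0 (lt_le_trans q2c).
  lra.
pose d : R := ratr (e ^+ 2).
have d_gt0 : 0 < d by rewrite ltr0q exprn_gt0.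
have grow n : 1 + n%:R * d <=
    generated_process DR (mkseq omega n) * generated_process ER (mkseq omega n).
  apply: le_trans (bernoulli_inequality n (ltW d_gt0)) _.
  rewrite -generated_processM /generated_process size_mkseq.
  rewrite -[n in _ ^+ n]card_ord -prodr_const; apply: ler_prod => i _.
  rewrite addr_ge0 ?(ltW d_gt0) //= /d -(rmorph1 (ratr : {rmorphism rat -> R})).
  by rewrite -rmorphD -rmorphM ler_rat DE.
pose N := (Num.truncn (`|A| * `|B| / d)).+1.
have := grow N; apply/negP; rewrite -ltNge.
have /(le_lt_trans _) : `|A| * `|B| < 1 + N%:R * d.
  by rewrite ltr_wpDl // -ltr_pdivrMr // truncnS_gt.
apply; apply: ler_pM; rewrite ?generated_process_ge0 //.
  by rewrite (le_trans (DA N _)) // ler_norm.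
by rewrite (le_trans (EB N _)) // ler_norm.
Qed.

Theorem proposition31 (R : realType) (omega : binary_path)
    (I J : interval_forecast R) :
  weakly_ML_forecasts omega I -> weakly_ML_forecasts omega J ->
  (forecast_set I `&` forecast_set J !=set0) /\
  exists2 K : interval_forecast R,
    forecast_set K = forecast_set I `&` forecast_set J &
    weakly_ML_forecasts omega K.
Proof.
move=> Iomega Jomega.
have [a [b [a0 ab b1 IE]]] := forecast_setP I.
have [c [d [c0 cd d1 JE]]] := forecast_setP J.
have Iab p : forecast_set I p -> a <= p <= b by rewrite IE /= in_itv.
have Jcd p : forecast_set J p -> c <= p <= d by rewrite JE /= in_itv.
have cb : c <= b.
  apply: (weakly_ML_forecasts_le Iomega Jomega) => [p /Iab/andP[]|p /Jcd/andP[]| |] //.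
    exact: le_trans ab.
  exact: le_trans d1.
have ad : a <= d.
  apply: (weakly_ML_forecasts_le Jomega Iomega) => [p /Jcd/andP[]|p /Iab/andP[]| |] //.
    exact: le_trans cd.
  exact: le_trans b1.
pose l := Num.max a c; pose u := Num.min b d.
have lu : l <= u by rewrite ge_max !le_min ab ad cb cd.
have l0 : 0 <= l by rewrite le_max a0.
have u1 : u <= 1 by rewrite ge_min b1.
have KE : [set` `[l, u]] = forecast_set I `&` forecast_set J.
  rewrite IE JE; apply/seteqP; split => p /=; rewrite !in_itv /= ge_max le_min.
    by move=> /andP[/andP[-> ->] /andP[-> ->]].
  by move=> [/andP[-> ->] /andP[-> ->]].
have inK p : l <= p <= u -> (forecast_set I `&` forecast_set J) p.
  by rewrite -KE /= in_itv.
split; first by exists l; apply: inK; rewrite lexx.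
have KP : exists a b : R, [/\ 0 <= a, a <= b, b <= 1 &
    forecast_set I `&` forecast_set J = [set` `[a, b]]].
  by exists l, u.
exists (IntervalForecast KP) => // _ [D [D0 lscD ->]] [_ /supermartingale_trim DK].
have bet0 b := bet_ge0 b (trim_ge0 D0).
have lsc_bet b := lower_semicomputable_bet b (lower_semicomputable_trim D0 lscD).
have Du s : u * trim D s true + (1 - u) * trim D s false <= 1.
  by apply: DK; apply: inK; rewrite lu lexx.
have Dl s : l * trim D s true + (1 - l) * trim D s false <= 1.
  by apply: DK; apply: inK; rewrite lu lexx.
have [A ubA] : exists A, forall n, (0 < n)%N ->
    generated_process (bet true (trim D)) (mkseq omega n) <= A.
  have [ub|ud] : u = b \/ u = d by rewrite /u; case: leP; [left|right].
  - apply: (weakly_ML_forecasts_bounded Iomega (bet0 _) (lsc_bet _)).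
    move=> s p /Iab/andP[ap pb].
    by apply: bet_true_le1 (Du s); rewrite ?ub // (le_trans a0).
  - apply: (weakly_ML_forecasts_bounded Jomega (bet0 _) (lsc_bet _)).
    move=> s p /Jcd/andP[cp pd].
    by apply: bet_true_le1 (Du s); rewrite ?ud // (le_trans c0).
have [B ubB] : exists B, forall n, (0 < n)%N ->
    generated_process (bet false (trim D)) (mkseq omega n) <= B.
  have [la|lc] : l = a \/ l = c by rewrite /l; case: leP; [right|left].
  - apply: (weakly_ML_forecasts_bounded Iomega (bet0 _) (lsc_bet _)).
    move=> s p /Iab/andP[ap pb].
    by apply: bet_false_le1 (Dl s); rewrite ?la // (le_trans pb).
  - apply: (weakly_ML_forecasts_bounded Jomega (bet0 _) (lsc_bet _)).
    move=> s p /Jcd/andP[cp pd].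
    by apply: bet_false_le1 (Dl s); rewrite ?lc // (le_trans pd).
apply: le_lt_trans (ltry (A * B)); apply: ge_ereal_sup => _ [n n0 <-].
rewrite lee_fin -(generated_process_trim _ D0) -generated_process_bet.
by apply: ler_pM; rewrite ?ubA ?ubB // generated_process_ge0.
Qed.
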